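(* Let $n\ge 2$ be an integer, let $R,H>0$, and let $$\Omega=\{(x,y): x\in\mathbb{R}^{n-1},\ y\in\mathbb{R},\ |x|<R,\ |y|<H\}\subset\mathbb{R}^n .$$ Suppose $M:(0,H)\to\mathbb{R}_+$ is a decreasing function such that $$\int_0^H \log^+\log^+ M(y)\,dy<+\infty .$$ Let $\mathcal{H}_M$ be the set of all functions $u$ harmonic in $\Omega$ and satisfying $|u(x,y)|\le M(|y|)$ for all $(x,y)\in\Omega$ with $y\neq 0$. Then $\mathcal{H}_M$ is uniformly bounded on every compact subset of $\Omega$; that is, for every compact $K\subset\Omega$, $$\sup_{u\in\mathcal{H}_M}\ \sup_{K}|u|<+\infty .$$
   Context: Here $|x|$ is the Euclidean norm. The function $\log^+$ is defined by $\log^+ x=\log x$ for $x\ge 1$ and $\log^+ x=0$ for $x\le 1$ (including $x = 0$). *)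

(* Defs.v *)
From HB Require Import structures.
From mathcomp Require Import all_boot all_order all_algebra.
From mathcomp Require Import all_classical all_reals all_analysis.

Set Implicit Arguments.
Unset Strict Implicit.
Unset Printing Implicit Defensive.

Import Order.TTheory GRing.Theory Num.Theory.
Import numFieldNormedType.Exports.

Local Open Scope classical_set_scope.
Local Open Scope ring_scope.

(* The norm `|x| that the library puts on 'rV[R]_d is the sup norm; it induces
   the same topology, but the cylinder below is round, so the Euclidean norm
   is needed. *)
Definition enorm (R : realType) (d : nat) (x : 'rV[R]_d) : R :=
  Num.sqrt (\sum_(i < d) x 0 i ^+ 2).

Definition logp (R : realType) (x : R) : R := if 1 <= x then ln x else 0.

Definition partial (R : realType) (d : nat) (i : 'I_d) (u : 'rV[R]_d -> R) :
  'rV[R]_d -> R := 'D_(delta_mx 0 i) u.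

Definition laplacian (R : realType) (d : nat) (u : 'rV[R]_d -> R) :
  'rV[R]_d -> R := fun p => \sum_(i < d) partial i (partial i u) p.

Definition continuous_on (R : realType) (d : nat) (D : set 'rV[R]_d)
  (u : 'rV[R]_d -> R) : Prop := forall p, D p -> {for p, continuous u}.

(* Functions on an open set D are represented by total functions; for open D
   the conditions below involve only the values of u on D. *)
Definition C2_on (R : realType) (d : nat) (D : set 'rV[R]_d)
  (u : 'rV[R]_d -> R) : Prop :=
  [/\ continuous_on D u,
      forall i, (forall p, D p -> derivable u p (delta_mx 0 i)) /\
        continuous_on D (partial i u) &
      forall i j,
        (forall p, D p -> derivable (partial i u) p (delta_mx 0 j)) /\
        continuous_on D (partial j (partial i u))].

Definition harmonic_on (R : realType) (d : nat) (D : set 'rV[R]_d)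
  (u : 'rV[R]_d -> R) : Prop :=
  C2_on D u /\ forall p, D p -> laplacian u p = 0.

(* A point (x, y) of R^m x R is the row vector row_mx x y in R^(m + 1). *)
Definition xpart (R : realType) (m : nat) (p : 'rV[R]_(m + 1)) : 'rV[R]_m :=
  lsubmx p.

Definition ypart (R : realType) (m : nat) (p : 'rV[R]_(m + 1)) : R :=
  rsubmx p 0 0.

Definition cylinder (R : realType) (m : nat) (r h : R) :
  set 'rV[R]_(m + 1) := [set p | enorm (xpart p) < r /\ `|ypart p| < h].

Arguments cylinder {R} m r h _.

(* Only the values of M on (0, h) matter. *)
Definition harmonic_majorized (R : realType) (m : nat) (r h : R) (M : R -> R) :
  set ('rV[R]_(m + 1) -> R) :=
  [set u | harmonic_on (cylinder m r h) u /\
     forall p, cylinder m r h p -> ypart p != 0 -> `|u p| <= M `|ypart p|].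

Arguments harmonic_majorized {R} m r h M _.

(* Main.v *)
(* Let A_k = exp (2 ^ k) and let w_k be the width of {y : M y > A_k}; the loglog
   hypothesis makes the w_k summable.  Off the strip |y| <= w_(k-1), a function u
   of the family is bounded by A_(k-1).  If moreover |u| <= A_(k+1) on the box of
   radius L d around p, where L is a large constant and d is slightly larger than
   w_(k-1), then the finite differences of u of order N = 2 ^ (k-3) and step d / N
   in the direction y are at most c ^ N A_(k+1) with c small, and Newton
   extrapolation from nodes off the strip gives |u p| <= A_k.  Since u is bounded
   near p by some A_n, descending induction on n, using boxes whose total radius
   is a tail of a convergent series, yields |u p| <= A_m with m depending only on
   the distance from p to the boundary.

   The difference estimate iterates a Lipschitz bound for harmonic functions,
   obtained by comparing u(x, y) - u(x, -y) on a half-box with a quadratic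
   barrier; differences of harmonic functions being harmonic, neither their
   smoothness nor any integral representation is needed. *)
Require Import Defs.
From HB Require Import structures.
From mathcomp Require Import all_boot all_order all_algebra.
From mathcomp Require Import all_classical all_reals all_analysis.
From mathcomp Require Import measurable_realfun.
From mathcomp Require Import ring lra zify.

Set Implicit Arguments.
Unset Strict Implicit.
Unset Printing Implicit Defensive.

Import Order.TTheory GRing.Theory Num.Theory.
Import numFieldNormedType.Exports.

Local Open Scope classical_set_scope.
Local Open Scope ring_scope.

(** * Harmonicity through second differences *)

Definition sdiff (R : realType) (d : nat) (u : 'rV[R]_d -> R) (t : R)
    (p : 'rV[R]_d) (i : 'I_d) : R :=
  u (p + t *: delta_mx 0 i) + u (p - t *: delta_mx 0 i) - 2 * u p.

(* The Laplace equation expressed with second differences instead of second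
   derivatives: a form stable by translations, reflections and finite
   differences, and which contradicts strict subharmonicity at a maximum. *)
Definition sharmonic_at (R : realType) (d : nat) (u : 'rV[R]_d -> R)
    (p : 'rV[R]_d) : Prop :=
  {for p, continuous u} /\
  forall eps : R, 0 < eps -> \forall t \near (0 : R)^'+,
    `|\sum_(i < d) sdiff u t p i| <= eps * t ^+ 2.

Lemma is_derive_remainder (R : realType) (f : R -> R) (x df : R) :
  is_derive x 1 f df -> forall eps : R, 0 < eps -> exists2 eta : R, 0 < eta &
    forall t, `|t| < eta -> `|f (x + t) - f x - df * t| <= eps * `|t|.
Proof.
move=> [dfx <-] eps eps0.
have /derivable_nbhs := dfx => H.
have /eqaddoP := H => /(_ eps eps0) /nbhs_norm0P [eta /= eta0 Heta].
exists eta => // t /Heta /=.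
rewrite !fctE /= scaler1 addrC [t + x]addrC => h.
rewrite (_ : f (x + t) - f x - _ = f (x + t) + - (f x + t *: 'D_1 f x)).
  by rewrite addrC.
by rewrite /GRing.scale /= ; ring.
Qed.

(** The mean value theorem on [[0, t]] for [phi s = g s + g (- s) - g2 * s ^+ 2] reduces the claim
    to the first-order expansion of [g'] at 0. *)
Lemma second_difference (R : realType) (g g' : R -> R) (g2 r : R) :
  0 < r -> (forall t : R, `|t| < r -> is_derive t 1 g (g' t)) ->
  is_derive (0 : R) 1 g' g2 ->
  forall eps : R, 0 < eps -> \forall t \near (0 : R)^'+,
    `|g t + g (- t) - 2 * g 0 - g2 * t ^+ 2| <= eps * t ^+ 2.
Proof.
move=> r0 dg dg' eps eps0.
(* The error is met twice, at [c] and at [- c], hence [eps / 2]. *)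
have [|eta eta0 Heta] := is_derive_remainder dg' (eps := eps / 2).
  by rewrite divr_gt0.
near=> t.
have t0 : 0 < t by near: t; exact: nbhs_right_gt.
have tr : t < r by near: t; exact: nbhs_right_lt.
have teta : t < eta by near: t; exact: nbhs_right_lt.
pose phi (s : R) := g s + g (- s) - g2 * s ^+ 2.
pose dphi (s : R) := g' s - g' (- s) - 2 * g2 * s.
have dphiP (s : R) : `|s| < r -> is_derive s 1 phi (dphi s).
  move=> sr.
  have ds := dg s sr.
  have dNs : is_derive (- s) 1 g (g' (- s)) by apply: dg; rewrite normrN.
  have dsq : is_derive s 1 (fun s : R => s ^+ 2) (2 * s).
    apply: is_derive_eq; rewrite /GRing.scale /=. ring.
  rewrite /phi /dphi; apply: is_derive_eq.
  by rewrite /GRing.scale /=; ring.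
have [s /[!in_itv]/= /andP[s0 st] | |c /[!in_itv]/= /andP[c0 ct] E] := @MVT R phi dphi 0 t t0.
- by apply: dphiP; rewrite gtr0_norm// (lt_trans st).
- apply: derivable_within_continuous => s /[!in_itv]/= /andP[s0 st].
  have : is_derive s 1 phi (dphi s).
    by apply: dphiP; rewrite ger0_norm// (le_lt_trans st).
  by case.
have -> : g t + g (- t) - 2 * g 0 - g2 * t ^+ 2 = phi t - phi 0.
  by rewrite /phi oppr0; ring.
rewrite E subr0 normrM (gtr0_norm t0) expr2 mulrA ler_wpM2r ?(ltW t0)//.
have h1 : `|g' c - g' 0 - g2 * c| <= eps / 2 * c.
  by have := Heta c; rewrite add0r gtr0_norm//; apply; apply: lt_trans teta.
have h2 : `|g' (- c) - g' 0 - g2 * - c| <= eps / 2 * c.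
  have := Heta (- c); rewrite add0r normrN gtr0_norm//; apply.
  exact: lt_trans teta.
have -> : dphi c = (g' c - g' 0 - g2 * c) - (g' (- c) - g' 0 - g2 * - c).
  by rewrite /dphi; ring.
rewrite (le_trans (ler_normB _ _))// (le_trans (lerD h1 h2))//.
by rewrite -mulrDl -splitr ler_pM2l// ltW.
Unshelve. all: by end_near. Qed.

Lemma rV_norm_le (R : realType) (d : nat) (x : 'rV[R]_d) (r : R) :
  0 <= r -> (`|x| <= r) = [forall i, `|x 0 i| <= r].
Proof.
move=> r0; rewrite [`|x|]/Num.norm /= mx_normrE.
apply/bigmax_leP/forallP => [[_ H] i|H]; first exact: (H (0, i)).
by split=> // -[i j] _ /=; rewrite (ord1 i).
Qed.

Lemma rV_norm_coord (R : realType) (d : nat) (x : 'rV[R]_d) i :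
  `|x 0 i| <= `|x|.
Proof. by have := rV_norm_le x (normr_ge0 x); rewrite lexx => /esym/forallP. Qed.

Lemma norm_delta_mx (R : realType) (d : nat) (i : 'I_d) (t : R) :
  `|t *: delta_mx 0 i : 'rV[R]_d| = `|t|.
Proof.
apply/eqP; rewrite eq_le; apply/andP; split.
  rewrite rV_norm_le//; apply/forallP => j; rewrite !mxE eqxx /=.
  by case: eqP => _; rewrite ?mulr1// mulr0 normr0.
apply: le_trans (rV_norm_coord _ i).
by rewrite !mxE !eqxx mulr1.
Qed.

Lemma is_derive_line (R : realType) (d : nat) (u : 'rV[R]_d -> R)
    (p e : 'rV[R]_d) (t : R) :
  derivable u (p + t *: e) e ->
  is_derive t 1 (fun s : R => u (p + s *: e)) ('D_e u (p + t *: e)).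
Proof.
move=> du.
have E : (fun h : R => h^-1 *: (((fun s : R => u (p + s *: e)) \o shift t) (h *: 1)
            - u (p + t *: e))) =
         (fun h : R => h^-1 *: ((u \o shift (p + t *: e)) (h *: e) - u (p + t *: e))).
  apply/funext => h /=; congr (_ *: (u _ - _)).
  by rewrite scaler1 scalerDl addrCA.
by split; [rewrite /derivable E | rewrite /derive E].
Qed.

(** Along each axis the second difference is the pure second derivative times [t ^+ 2] up to a small
    error; summed over the axes, the main terms form the Laplacian and cancel. *)
Lemma harmonic_sharmonic (R : realType) (d : nat) (D : set 'rV[R]_d)
    (u : 'rV[R]_d -> R) (p : 'rV[R]_d) :
  open D -> harmonic_on D u -> D p -> sharmonic_at u p.
Proof.
move=> oD [[cu du d2u] lap0] Dp; split; first exact: cu.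
move=> eps eps0.
have /nbhs_normP [r /= r0 rD] : nbhs p D by exact: open_nbhs_nbhs.
have Dline i (t : R) : `|t| < r -> D (p + t *: delta_mx 0 i).
  move=> tr; apply: rD => /=.
  by rewrite opprD addNKr normrN norm_delta_mx.
(* Each axis receives the share [eps / (d + 1)], which makes sense even for [d = 0]. *)
have dd0 : 0 < (d%:R + 1 : R) by rewrite ltr_wpDl.
have H (i : 'I_d) : \forall t \near (0 : R)^'+,
    `|sdiff u t p i - partial i (partial i u) p * t ^+ 2|
      <= eps / (d%:R + 1) * t ^+ 2.
  have dg (t : R) : `|t| < r -> is_derive t 1
      (fun s : R => u (p + s *: delta_mx 0 i))
      (partial i u (p + t *: delta_mx 0 i)).
    by move=> tr; apply: is_derive_line; apply: (du i).1; exact: Dline.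
  have dg' : is_derive (0 : R) 1
      (fun s : R => partial i u (p + s *: delta_mx 0 i))
      (partial i (partial i u) p).
    have := @is_derive_line _ _ (partial i u) p (delta_mx 0 i) 0.
    by rewrite scale0r addr0; apply; apply: (d2u i i).1.
  have := second_difference r0 dg dg' (divr_gt0 eps0 dd0).
  by apply: filterS => t; rewrite scale0r addr0 scaleNr.
have {}H : \forall t \near (0 : R)^'+, forall i : 'I_d,
    `|sdiff u t p i - partial i (partial i u) p * t ^+ 2|
      <= eps / (d%:R + 1) * t ^+ 2 by exact: filter_forall.
apply: filterS H => t H.
have -> : \sum_(i < d) sdiff u t p i =
    \sum_(i < d) (sdiff u t p i - partial i (partial i u) p * t ^+ 2).
  rewrite [RHS]sumrB -mulr_suml.
  by have := lap0 p Dp; rewrite /laplacian => ->; rewrite mul0r subr0.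
apply: le_trans (ler_norm_sum _ _ _) _.
apply: (@le_trans _ _ (\sum_(i < d) eps / (d%:R + 1) * t ^+ 2)).
  exact: ler_sum.
rewrite sumr_const card_ord -[X in X <= _]mulr_natl mulrA.
rewrite ler_wpM2r ?sqr_ge0// mulrCA ler_piMr ?(ltW eps0)//.
by rewrite ler_pdivrMr// mul1r lerDl.
Qed.

Lemma sharmonicB (R : realType) (d : nat) (u v : 'rV[R]_d -> R) p :
  sharmonic_at u p -> sharmonic_at v p -> sharmonic_at (fun q => u q - v q) p.
Proof.
move=> [cu hu] [cv hv]; split; first exact: (cvgB cu cv).
move=> eps eps0; have e2 : 0 < eps / 2 by rewrite divr_gt0.
near=> t.
have -> : \sum_(i < d) sdiff (fun q => u q - v q) t p i =
  \sum_(i < d) sdiff u t p i - \sum_(i < d) sdiff v t p i.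
  by rewrite -sumrB; apply: eq_bigr => i _; rewrite /sdiff; ring.
rewrite [eps]splitr mulrDl (le_trans (ler_normB _ _))// lerD//.
- by near: t; exact: hu.
- by near: t; exact: hv.
Unshelve. all: by end_near. Qed.

Lemma sharmonicN (R : realType) (d : nat) (u : 'rV[R]_d -> R) p :
  sharmonic_at u p -> sharmonic_at (fun q => - u q) p.
Proof.
move=> [cu hu]; split; first exact: (cvgN cu).
move=> eps /hu; apply: filterS => t.
rewrite -normrN -sumrN; congr (`|_| <= _).
by apply: eq_bigr => i _; rewrite /sdiff; ring.
Qed.

Lemma sharmonic_shift (R : realType) (d : nat) (u : 'rV[R]_d -> R) a p :
  sharmonic_at u (a + p) -> sharmonic_at (fun q => u (a + q)) p.
Proof.
move=> [cu hu]; split.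
  have cs : {for p, continuous (fun q => a + q)}.
    by apply: continuousD; [exact: cst_continuous|move=> ?].
  exact: (continuous_comp cs cu).
move=> eps /hu; apply: filterS => t; congr (`|_| <= _).
by apply: eq_bigr => i _; rewrite /sdiff !addrA.
Qed.

(** Reflection in the hyperplane where coordinate [i0] vanishes. *)
Definition flip (R : realType) (d : nat) (i0 : 'I_d) (p : 'rV[R]_d) :
  'rV[R]_d := p - (2 * p 0 i0) *: delta_mx 0 i0.

Lemma flip_coord (R : realType) (d : nat) (i0 : 'I_d) (p : 'rV[R]_d) i :
  flip i0 p 0 i = if i == i0 then - p 0 i else p 0 i.
Proof.
by rewrite /flip !mxE eqxx /=; case: eqP => [->|_]; rewrite ?mulr1 ?mulr0; ring.
Qed.

(** The reflection reverses the step along [i0] and fixes the other steps; [sdiff] is even in its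
    step. *)
Lemma sharmonic_flip (R : realType) (d : nat) (i0 : 'I_d)
    (u : 'rV[R]_d -> R) p :
  sharmonic_at u (flip i0 p) -> sharmonic_at (fun q => u (flip i0 q)) p.
Proof.
move=> [cu hu]; split.
  have cs : {for p, continuous (flip i0)}.
    apply: (@continuousB R _ _ (fun q => q)); first by move=> ?.
    apply: continuousZr_tmp; apply: continuousM; first exact: cst_continuous.
    exact: coord_continuous.
  exact: (continuous_comp cs cu).
move=> eps /hu; apply: filterS => t; congr (`|_| <= _).
apply: eq_bigr => i _; rewrite /sdiff.
have E (s : R) : flip i0 (p + s *: delta_mx 0 i) =
    flip i0 p + (if i == i0 then - s else s) *: delta_mx 0 i.
  apply/rowP => j; rewrite flip_coord [RHS]mxE flip_coord !mxE /=.
  by have [->|ni] := eqVneq i i0; have [->|nj] := eqVneq j i0;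
    rewrite ?eqxx ?(negPf ni) ?(negPf nj) ?[i0 == i]eq_sym ?(negPf ni) /=; try ring.
rewrite -scaleNr !E; case: eqP => _; rewrite ?opprK -?scaleNr; ring.
Qed.

Lemma continuous_at_sum (R : realType) (T : topologicalType) (I : Type)
    (s : seq I) (f : I -> T -> R) (x : T) :
  (forall i, {for x, continuous (f i)}) ->
  {for x, continuous (fun y => \sum_(i <- s) f i y)}.
Proof.
move=> cf; elim: s => [|i s IH].
  rewrite (_ : (fun y => _) = cst 0); first exact: cst_continuous.
  by apply/funext => y; rewrite big_nil.
rewrite (_ : (fun y => _) = f i + (fun y => \sum_(j <- s) f j y)).
  exact: continuousD (cf i) IH.
by apply/funext => y; rewrite big_cons.
Qed.

(** * Quadratic barrier on a half-box and the Lipschitz bound *)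

Section barrier.
Context {R : realType} {d : nat} (i0 : 'I_d) (rho : R).

(** The concave coefficient [d] along [i0] outweighs the [d - 1] convex squares, which makes the sum
    strictly superharmonic. The linear coefficient [d + 1] then gives the value 1 at [x = rho]. *)
Let profile (i : 'I_d) (x : R) : R :=
  if i == i0 then (d%:R + 1) * (x / rho) - d%:R * (x / rho) ^+ 2
  else (x / rho) ^+ 2.

Definition barrier (q : 'rV[R]_d) : R := \sum_(i < d) profile i (q 0 i).

Lemma barrier_axis s :
  barrier (s *: delta_mx 0 i0) = (d%:R + 1) * (s / rho) - d%:R * (s / rho) ^+ 2.
Proof.
rewrite /barrier (bigD1 i0)//= big1 => [|i ni].
  by rewrite /profile !mxE !eqxx mulr1 addr0.
by rewrite /profile (negPf ni) !mxE (negPf ni) andbF mulr0 mul0r expr0n.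
Qed.

Lemma continuous_barrier : continuous barrier.
Proof.
move=> q.
have cp i : {for q, continuous (fun q : 'rV[R]_d => profile i (q 0 i))}.
  have ci : {for q, continuous (fun q : 'rV[R]_d => q 0 i / rho)}.
    by apply: continuousM; [exact: coord_continuous|exact: cst_continuous].
  have ci2 : {for q, continuous (fun q : 'rV[R]_d => (q 0 i / rho) ^+ 2)}.
    exact: continuousM.
  rewrite /profile; case: eqP => _ //.
  by apply: continuousB; apply: continuousM => //; exact: cst_continuous.
exact: (@continuous_at_sum R _ _ _ (fun i (q : 'rV[R]_d) => profile i (q 0 i)) q cp).
Qed.

Lemma sdiff_barrier t q i :
  sdiff barrier t q i =
  (if i == i0 then - (2 * d%:R) else 2) * (t / rho) ^+ 2.
Proof.
rewrite /sdiff.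
have E s : barrier (q + s *: delta_mx 0 i) =
    profile i (q 0 i + s) + \sum_(j < d | j != i) profile j (q 0 j).
  rewrite /barrier (bigD1 i)//= !mxE !eqxx mulr1; congr (_ + _).
  by apply: eq_bigr => j ji; rewrite !mxE (negPf ji) andbF mulr0 addr0.
have -> : barrier q = barrier (q + 0 *: delta_mx 0 i).
  by rewrite scale0r addr0.
by rewrite -scaleNr !E addr0 /profile; case: eqP => _; ring.
Qed.

(** The balance is [2 (d - 1) - 2 d = - 2], and it is exact because the barrier is quadratic. *)
Lemma sum_sdiff_barrier t q :
  \sum_(i < d) sdiff barrier t q i = - 2 * (t / rho) ^+ 2.
Proof.
under eq_bigr do rewrite sdiff_barrier.
rewrite -mulr_suml; congr (_ * _).
rewrite (bigD1 i0)//= eqxx (eq_bigr (fun=> 2)) => [|i /negPf ->//].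
have card_ne : #|[pred i | i != i0]| = d.-1.
  by have := cardC1 i0; rewrite card_ord.
have dE : d%:R = d.-1%:R + 1 :> R.
  by rewrite natr1 prednK// (leq_trans _ (ltn_ord i0)).
by rewrite sumr_const card_ne dE -[2 *+ _]mulr_natl; ring.
Qed.

Hypothesis rho0 : 0 < rho.

Definition halfbox : set 'rV[R]_d :=
  [set q | forall i, `[if i == i0 then 0 else - rho, rho]%classic (q 0 i)].

Lemma profile_ge0 i x : (if i == i0 then 0 else - rho) <= x <= rho ->
  0 <= profile i x.
Proof.
rewrite /profile; case: eqP => _ /andP[x0 xr]; last exact: sqr_ge0.
have a0 : 0 <= x / rho by rewrite divr_ge0// ltW.
have a1 : x / rho <= 1 by rewrite ler_pdivrMr// mul1r.
(* With [a = x / rho], the profile along [i0] equals [a + d a (1 - a)]. *)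
have : 0 <= d%:R * (x / rho * (1 - x / rho)).
  by apply: mulr_ge0 => //; apply: mulr_ge0 => //; rewrite subr_ge0.
by move: (x / rho) (d%:R) a0 => a n a0; nra.
Qed.

Lemma profile_ge1 i x : x = rho \/ (i != i0 /\ x = - rho) -> 1 <= profile i x.
Proof.
have rr : rho / rho = 1 by rewrite divff// gt_eqF.
rewrite /profile => -[->|[/negPf -> ->]]; rewrite ?mulNr rr; last first.
  by rewrite sqrrN expr1n.
by case: ifP => _; rewrite expr1n// !mulr1 addrAC subrr add0r.
Qed.

Lemma barrier_ge0 q : halfbox q -> 0 <= barrier q.
Proof.
move=> Hq; apply: sumr_ge0 => i _; apply: profile_ge0.
by have := Hq i; rewrite /= in_itv.
Qed.

Lemma barrier_ge1 q i : halfbox q ->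
  q 0 i = rho \/ (i != i0 /\ q 0 i = - rho) -> 1 <= barrier q.
Proof.
move=> Hq qi; rewrite /barrier (bigD1 i)//= -[X in X <= _]addr0 lerD//.
  exact: profile_ge1.
apply: sumr_ge0 => j _; apply: profile_ge0.
by have := Hq j; rewrite /= in_itv.
Qed.

Lemma compact_halfbox : compact halfbox.
Proof.
apply: (@rV_compact R d (fun i => `[if i == i0 then 0 else - rho, rho]%classic)).
by move=> i; exact: segment_compact.
Qed.

Lemma halfbox_norm q : halfbox q -> `|q| <= rho /\ `|flip i0 q| <= rho.
Proof.
move=> Hq.
have q_le i : `|q 0 i| <= rho.
  have := Hq i; rewrite /= in_itv /= ler_norml => /andP[a ->]; rewrite andbT.
  by apply: le_trans a; case: eqP => // _; rewrite oppr_le0 ltW.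
have r0 := ltW rho0.
split; rewrite rV_norm_le//; apply/forallP => i //.
by rewrite flip_coord; case: eqP => _; rewrite ?normrN.
Qed.

End barrier.

(** The antisymmetrization [v] of [u] vanishes on the face where coordinate [i0] is 0 and is at most
    [2 B] on the other faces, where the barrier is at least 1. So [w] is nonpositive on the
    boundary, and strict superharmonicity of the barrier forbids an interior maximum. The bound is
    then read on the axis. *)
Lemma sharmonic_lipschitz (R : realType) (d : nat) (i0 : 'I_d)
    (u : 'rV[R]_d -> R) (z : 'rV[R]_d) (rho B s : R) :
  0 < rho -> 0 < B ->
  (forall q, `|q - z| <= rho -> sharmonic_at u q /\ `|u q| <= B) ->
  0 <= s <= rho ->
  `|u (z + s *: delta_mx 0 i0) - u (z - s *: delta_mx 0 i0)|
    <= 2 * (d%:R + 1) * (s / rho) * B.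
Proof.
move=> rho0 B0 Hu /andP[s0 srho].
wlog suff main : u Hu / u (z + s *: delta_mx 0 i0) - u (z - s *: delta_mx 0 i0)
    <= 2 * (d%:R + 1) * (s / rho) * B.
  rewrite ler_norml main// andbT lerNl opprB.
  have := main (fun q => - u q); rewrite opprK addrC; apply => q /Hu[uq ub].
  by split; [exact: sharmonicN|rewrite normrN].
pose U q := u (z + q).
have HU q : `|q| <= rho -> sharmonic_at U q /\ `|U q| <= B.
  move=> qr; have [|? ?] := Hu (z + q); first by rewrite addrAC subrr add0r.
  by split=> //; exact: sharmonic_shift.
pose v q := U q - U (flip i0 q).
pose w q := v q - 2 * B * barrier i0 rho q.
have Hv q : halfbox i0 rho q -> sharmonic_at v q /\ v q <= 2 * B.
  move=> /(halfbox_norm rho0)[/HU[Uq bq] /HU[Ufq bfq]]; split.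
    by apply: sharmonicB => //; exact: sharmonic_flip.
  rewrite mulr_natl mulr2n lerD//; first exact: ler_normlW.
  by rewrite lerNl; move: bfq; rewrite ler_norml => /andP[].
have B20 : 0 < 2 * B by rewrite mulr_gt0.
have cw : {within halfbox i0 rho, continuous w}.
  apply: continuous_in_subspaceT => q /[!inE] /Hv[[cv _] _].
  apply: continuousB => //; apply: continuousM; first exact: cst_continuous.
  exact: continuous_barrier.
have Haxis : halfbox i0 rho (s *: delta_mx 0 i0).
  move=> i; rewrite /= in_itv/= !mxE eqxx/=.
  case: eqP => _; rewrite ?mulr1 ?mulr0 ?s0//.
  by rewrite oppr_le0 ltW.
have [c /[!inE] Hc wmax] :=
  compact_EVT_max (ex_intro _ _ Haxis) (@compact_halfbox R d i0 rho) cw.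
have w_le0 : w c <= 0.
  have [|] := boolP [forall i, (if i == i0 then 0 else - rho) < c 0 i < rho].
    (* At an interior maximum the second differences of [w] are nonpositive. *)
    move=> /forallP Ic; exfalso.
    have [[_ hv] _] := Hv c Hc.
    (* The barrier contributes [4 B t ^+ 2 / rho ^+ 2] to the second differences of [w]; half of
       this is allowed as error for [v], so the sum stays positive. *)
    have e0 : 0 < 2 * B / rho ^+ 2 by rewrite divr_gt0// exprn_gt0.
    near (0 : R)^'+ => t.
    have t0 : 0 < t by near: t; exact: nbhs_right_gt.
    have tc : forall i, t <= c 0 i - (if i == i0 then 0 else - rho) /\
                        t <= rho - c 0 i.
      near: t; apply: filter_forall => i; have /andP[lo hi] := Ic i.
      near=> t; split; apply: ltW; near: t; apply: nbhs_right_lt;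
        by rewrite subr_gt0.
    have hvt : `|\sum_(i < d) sdiff v t c i| <= 2 * B / rho ^+ 2 * t ^+ 2.
      by near: t; exact: hv.
    have wneg : \sum_(i < d) sdiff w t c i <= 0.
      apply: sumr_le0 => i _.
      have Hpm (r : R) : `|r| = t -> w (c + r *: delta_mx 0 i) <= w c.
        move=> rt; apply: wmax; rewrite inE => j; rewrite /= in_itv/= !mxE eqxx/=.
        have := Hc j; rewrite /= in_itv/= => cj.
        have [ji|_] := eqVneq j i; last by rewrite mulr0 addr0.
        rewrite mulr1; have [h1 h2] := tc j.
        have := ler_norm r; have := ler_norm (- r); rewrite normrN rt.
        by move: cj h1 h2; case: ifP => _; move=> *; apply/andP; split; lra.
      have := Hpm t (gtr0_norm t0); have := Hpm (- t).
      rewrite normrN gtr0_norm// scaleNr => /(_ erefl).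
      by rewrite /sdiff; lra.
    have wE : \sum_(i < d) sdiff w t c i =
        \sum_(i < d) sdiff v t c i + 4 * (B / rho ^+ 2 * t ^+ 2).
      transitivity (\sum_(i < d) sdiff v t c i -
          2 * B * \sum_(i < d) sdiff (barrier i0 rho) t c i).
        rewrite mulr_sumr -sumrB; apply: eq_bigr => i _.
        by rewrite /sdiff /w; ring.
      by rewrite sum_sdiff_barrier expr_div_n; field; rewrite gt_eqF.
    have pos : 0 < B / rho ^+ 2 * t ^+ 2.
      by rewrite mulr_gt0 ?divr_gt0 ?exprn_gt0.
    move: hvt wneg; rewrite wE ler_norml => /andP[+ _].
    by move: pos; lra.
  (* The maximum is now on the boundary: either the barrier is at least 1 there, or [flip] fixes [c]
     and [v c = 0]. *)
  rewrite negb_forall => /existsP[i ci].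
  have [vs vle] := Hv c Hc.
  have big : 1 <= barrier i0 rho c -> w c <= 0.
    move=> b1; rewrite subr_le0 (le_trans vle)//.
    by rewrite ler_peMr// ltW.
  have := Hc i; rewrite /= in_itv/= => /andP[lo hi].
  have {ci} [hi'|lo'] : c 0 i = rho \/ c 0 i = if i == i0 then 0 else - rho.
    move: ci; rewrite negb_and -!leNgt => /orP[le|le]; [right|left].
      by apply/eqP; rewrite eq_le le lo.
    by apply/eqP; rewrite eq_le le hi.
  by apply: big; apply: (@barrier_ge1 _ _ _ _ rho0 c i) => //; left.
  move: lo'; have [-> c0|ni ci] := eqVneq i i0; last first.
    by apply: big; apply: (@barrier_ge1 _ _ _ _ rho0 c i) => //; right.
  rewrite /w /v (_ : flip i0 c = c) ?subrr ?sub0r.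
    by rewrite oppr_le0 mulr_ge0 ?(ltW B20)// barrier_ge0.
  by rewrite /flip c0 mulr0 scale0r subr0.
have := le_trans (wmax _ (mem_set Haxis)) w_le0.
rewrite /w subr_le0 barrier_axis /v /U.
have -> : flip i0 (s *: delta_mx 0 i0) = - s *: delta_mx 0 i0 :> 'rV[R]_d.
  by rewrite /flip !mxE !eqxx mulr1 -scalerBl; congr (_ *: _); ring.
rewrite scaleNr => /le_trans; apply.
have a0 : 0 <= d%:R * (s / rho) ^+ 2 :> R by rewrite mulr_ge0// sqr_ge0.
rewrite -subr_ge0 (_ : _ - _ = 2 * B * (d%:R * (s / rho) ^+ 2)); last by ring.
by rewrite mulr_ge0// ltW.
Unshelve. all: by end_near. Qed.

(** * Iterated differences and propagation of smallness *)

Definition fdiff (R : realType) (V : zmodType) (a : V) (u : V -> R) : V -> R :=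
  fun q => u (a + q) - u q.

(* Newton extrapolation: small values at the first [N] nodes and a small [N]-th
   difference control the values at all later nodes. *)
Lemma extrapolation (R : realType) (V : zmodType) (a : V) (N : nat)
    (u : V -> R) (b eps : R) (q : V) (m : nat) :
  0 <= b -> 0 <= eps ->
  (forall j, (j < N)%N -> `|u (q + a *+ j)| <= b) ->
  (forall j, (j + N <= m)%N -> `|iter N (fdiff a) u (q + a *+ j)| <= eps) ->
  `|u (q + a *+ m)| <= 2 ^+ m * (2 ^+ N * b + eps).
Proof.
have stepE j : a + (q + a *+ j) = q + a *+ j.+1 by rewrite addrCA mulrS.
elim: N u b m => [|N IH] u b m b0 eps0 ub diffb.
  have := diffb m; rewrite addn0 => /(_ (leqnn _)) /= h.
  rewrite (le_trans h)// expr0 mul1r (le_trans _ (_ : b + eps <= _))//.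
    by rewrite lerDr.
  by rewrite ler_peMl ?addr_ge0// exprn_ege1// ler1n.
have C0 : 0 <= 2 ^+ N.+1 * b + eps by rewrite addr_ge0// mulr_ge0// exprn_ge0.
(* The induction hypothesis is applied to [fdiff a u]: its first [N] node values are at most [2 b],
   and its [N]-th differences are those of order [N + 1] of [u]. Summing back doubles the bound at
   each node. *)
have g_le k : (k < m)%N ->
    `|fdiff a u (q + a *+ k)| <= 2 ^+ k * (2 ^+ N.+1 * b + eps).
  move=> km; rewrite exprSr -mulrA; apply: IH => //; first exact: mulr_ge0.
    move=> j jN; rewrite /fdiff stepE (le_trans (ler_normB _ _))//.
    by rewrite mulr_natl mulr2n lerD// ub// ltnW.
  by move=> j jk; rewrite -iterSr diffb// addnS (leq_ltn_trans jk).
suff main k : (k <= m)%N ->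
    `|u (q + a *+ k)| <= 2 ^+ k * (2 ^+ N.+1 * b + eps) by exact: main.
elim: k => [_|k IHk km].
  rewrite expr0 mul1r (le_trans (ub 0 _))// (le_trans _ (_ : 2 ^+ N.+1 * b <= _))//.
    by rewrite ler_peMl// exprn_ege1// ler1n.
  by rewrite lerDl.
have -> : u (q + a *+ k.+1) = u (q + a *+ k) + fdiff a u (q + a *+ k).
  by rewrite /fdiff stepE; ring.
rewrite (le_trans (ler_normD _ _))// exprS -mulrA mulr_natl mulr2n lerD//.
  by rewrite IHk// ltnW.
exact: g_le.
Qed.

(** Each difference gains the factor [kappa] by the Lipschitz bound and costs a layer of width [rho]
    of the box. *)
Lemma iter_fdiff_le (R : realType) (d : nat) (i0 : 'I_d) (t rho : R) (N : nat)
    (u : 'rV[R]_d -> R) (q : 'rV[R]_d) (B : R) :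
  t != 0 -> `|t| <= rho -> 0 < B ->
  (forall p, `|p - q| <= N%:R * rho -> sharmonic_at u p /\ `|u p| <= B) ->
  `|iter N (fdiff (t *: delta_mx 0 i0)) u q|
    <= (2 * (d%:R + 1) * (`|t| / rho)) ^+ N * B.
Proof.
move=> t0 trho; have tp : 0 < `|t| by rewrite normr_gt0.
have rho0 : 0 < rho by apply: lt_le_trans trho.
set kappa := 2 * (d%:R + 1) * (`|t| / rho).
have kappa0 : 0 < kappa.
  by rewrite /kappa !mulr_gt0 ?invr_gt0// ltr_wpDl.
set e := delta_mx 0 i0 : 'rV[R]_d.
elim: N u B => [|N IH] u B B0 Hu.
  by rewrite /= expr0 mul1r; apply: (Hu q _).2; rewrite subrr normr0 mul0r.
have sumN : N.+1%:R * rho = N%:R * rho + rho by rewrite -natr1 mulrDl mul1r.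
rewrite iterSr exprSr -mulrA; apply: IH; first exact: mulr_gt0.
move=> p pq; split.
  apply: sharmonicB.
    apply: sharmonic_shift; apply: (Hu _ _).1.
    rewrite sumN -addrA addrC (le_trans (ler_normD _ _))// lerD//.
    by rewrite norm_delta_mx.
  by apply: (Hu _ _).1; rewrite sumN (le_trans pq)// lerDl ltW.
(* A forward difference of step [t] is a symmetric difference of half-step [t / 2] about the
   midpoint; with radius [rho / 2] the ratio is still [|t| / rho]. *)
pose z := p + (t / 2) *: e.
have Hz x : `|x - z| <= rho / 2 -> sharmonic_at u x /\ `|u x| <= B.
  move=> xz; apply: Hu; rewrite sumN [X in _ <= X]addrC.
  rewrite (_ : x - q = ((x - z) + (t / 2) *: e) + (p - q)).
    rewrite (le_trans (ler_normD _ _))// lerD//.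
    rewrite (le_trans (ler_normD _ _))// [rho]splitr lerD//.
    by rewrite norm_delta_mx normrM [`|2^-1|]gtr0_norm ?invr_gt0// ler_pM2r ?invr_gt0.
  by apply/rowP => k; rewrite /z !mxE; ring.
have ht : 0 <= `|t| / 2 <= rho / 2.
  by rewrite divr_ge0//= ler_pM2r ?invr_gt0.
have r20 : 0 < rho / 2 by rewrite divr_gt0.
have := sharmonic_lipschitz i0 r20 B0 Hz ht.
have -> : `|t| / 2 / (rho / 2) = `|t| / rho by field; rewrite gt_eqF.
rewrite -/kappa; apply: le_trans; rewrite /fdiff /z -/e.
case: (ger0P t) => _.
  rewrite addrK -addrA -scalerDl -splitr [p + _]addrC//.
rewrite distrC -!addrA mulNr scaleNr subrr addr0 opprK -scalerDl -splitr.
by rewrite [p + _]addrC.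
Qed.

(** The constant L: the nodes lie within [2 delta] of the point, and [N] differences around a node
    use the radius [N rho = 8 (d + 1) e^16 delta]. *)
Definition reach (R : realType) (d : nat) : R := 2 + 8 * (d%:R + 1) * expR 16.

Lemma reach_gt0 (R : realType) (d : nat) : 0 < reach R d.
Proof. by rewrite /reach ltr_pwDl// !mulr_ge0 ?expR_ge0// addr_ge0. Qed.

(* The nodes [p + sigma (2 delta - j delta / N) e], [0 <= j <= 2 N], start at
   distance [2 delta] of [p] and reach [p] for [j = 2 N]; the first [N] of them
   lie at distance more than [delta]. *)
Lemma propagation_of_smallness (R : realType) (d : nat) (i0 : 'I_d)
    (u : 'rV[R]_d -> R) (p : 'rV[R]_d) (delta sigma b B : R) (N : nat) :
  (0 < N)%N -> 0 < delta -> `|sigma| = 1 -> 0 <= b -> 0 < B ->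
  (forall q, `|q - p| <= reach R d * delta -> sharmonic_at u q /\ `|u q| <= B) ->
  (forall s, delta < s <= 2 * delta ->
     `|u (p + (sigma * s) *: delta_mx 0 i0)| <= b) ->
  `|u p| <= 8 ^+ N * b + expR (- 16) ^+ N * B.
Proof.
move=> N0 delta0 sigma1 b0 B0 Hu ub.
have N0' : 0 < N%:R :> R by rewrite ltr0n.
have Nn0 : N%:R != 0 :> R by rewrite gt_eqF.
have dd0 : 0 < d%:R + 1 :> R by rewrite ltr_wpDl.
set e := delta_mx 0 i0 : 'rV[R]_d.
pose t := - (sigma * (delta / N%:R)).
pose q0 := p + (sigma * (2 * delta)) *: e.
have nodeE j : q0 + (t *: e) *+ j =
    p + (sigma * (2 * delta - j%:R * (delta / N%:R))) *: e.
  rewrite -scaler_nat scalerA /q0 -addrA -scalerDl; congr (_ + _ *: _).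
  by rewrite /t; ring.
have dN0 : 0 < delta / N%:R by rewrite divr_gt0.
have tE : `|t| = delta / N%:R by rewrite normrN normrM sigma1 mul1r gtr0_norm.
have ->: p = q0 + (t *: e) *+ (2 * N).
  rewrite nodeE natrM (_ : _ - _ = 0) ?mulr0 ?scale0r ?addr0//.
  by field.
(* Extrapolation to the node of index [2 N] costs [2 ^ (2 N) = 4 ^ N], which the quarter absorbs. *)
pose eps := (expR (- 16) / 4) ^+ N * B.
have eps0 : 0 <= eps.
  by rewrite mulr_ge0 ?(ltW B0)// exprn_ge0// divr_ge0// expR_ge0.
have -> : 8 ^+ N * b + expR (- 16) ^+ N * B =
    2 ^+ (2 * N) * (2 ^+ N * b + eps).
  have p2 : 2 ^+ (2 * N) = 4 ^+ N :> R by rewrite exprM; congr (_ ^+ _); ring.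
  have p8 : 8 ^+ N = 4 ^+ N * 2 ^+ N :> R.
    by rewrite -exprMn; congr (_ ^+ _); ring.
  have pe : expR (- 16) ^+ N = 4 ^+ N * (expR (- 16) / 4) ^+ N :> R.
    by rewrite -exprMn; congr (_ ^+ _); field.
  by rewrite p2 p8 pe /eps mulrDr !mulrA.
apply: extrapolation => // j jN.
  rewrite nodeE; apply: ub; have jN' : j%:R < N%:R :> R by rewrite ltr_nat.
  have h1 : j%:R * (delta / N%:R) < delta.
    by rewrite mulrCA gtr_pMr// ltr_pdivrMr// mul1r.
  have h2 : 0 <= j%:R * (delta / N%:R) by rewrite mulr_ge0// ltW.
  by apply/andP; split; lra.
(* Chosen so that the gain [2 (d + 1) |t| / rho] per difference is exactly [e^(-16) / 4]. *)
pose rho := 8 * (d%:R + 1) * expR 16 * (delta / N%:R).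
have E1 : 1 <= expR (16 : R) by rewrite -expR0 ler_expR.
have trho : `|t| <= rho.
  rewrite tE /rho ler_peMl ?(ltW dN0)// mulr_ege1//.
  have := ler0n R d; lra.
have t0 : t != 0 by rewrite -normr_gt0 tE.
have := @iter_fdiff_le R d i0 t rho N u (q0 + (t *: e) *+ j) B t0 trho B0.
have -> : 2 * (d%:R + 1) * (`|t| / rho) = expR (- 16) / 4.
  rewrite tE /rho expRN; field.
  by rewrite Nn0 !gt_eqF// expR_gt0.
apply=> q qj; apply: Hu.
rewrite (_ : q - p = (q - (q0 + (t *: e) *+ j)) + (q0 + (t *: e) *+ j - p)).
  rewrite (le_trans (ler_normD _ _))// /reach mulrDl addrC lerD//.
    rewrite nodeE addrAC subrr add0r norm_delta_mx normrM sigma1 mul1r ler_norml.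
    have jN2 : j%:R <= 2 * N%:R :> R.
      by rewrite -natrM ler_nat (leq_trans _ jN)// leq_addr.
    have h1 : j%:R * (delta / N%:R) <= 2 * delta.
      by rewrite mulrCA mulrC ler_pM2r// ler_pdivrMr.
    have h2 : 0 <= j%:R * (delta / N%:R) by rewrite mulr_ge0// ltW.
    by apply/andP; split; lra.
  rewrite (le_trans qj)// (_ : N%:R * rho = 8 * (d%:R + 1) * expR 16 * delta)//.
  by rewrite /rho; field.
by rewrite addrA subrK.
Qed.

(** * Doubly exponential levels *)

Definition tower (R : realType) (k : nat) : R := expR (2 ^+ k).

Lemma tower_gt0 (R : realType) k : 0 < tower R k.
Proof. exact: expR_gt0. Qed.

Lemma ler_tower (R : realType) k l : (k <= l)%N -> tower R k <= tower R l.
Proof. by move=> kl; rewrite ler_expR ler_weXn2l// ler1n. Qed.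

Lemma expR1_ge2 (R : realType) : 2 <= expR (1 : R).
Proof. by have := expR_ge1Dx (1 : R); lra. Qed.

(** With [N = 2 ^ j] the levels [j + 2], [j + 3], [j + 4] are [e^(4N)], [e^(8N)], [e^(16N)]. Since
    [8 <= e^3], the first term is at most [e^(7N)]; the second is exactly 1, which is why 16 was
    chosen. Each is at most half of [e^(8N)] because [e >= 2]. *)
Lemma tower_step (R : realType) (j : nat) :
  8 ^+ (2 ^ j) * tower R j.+2 + expR (- 16) ^+ (2 ^ j) * tower R j.+4
    <= tower R j.+3.
Proof.
set N := (2 ^ j)%N.
have towerE i : tower R (j + i) = expR ((N * 2 ^ i)%:R).
  by rewrite /tower natrM !natrX exprD.
have e2 := expR1_ge2 R.
have N1 : (1 <= N)%N by rewrite expn_gt0.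
have half i : (i < 8)%N -> expR ((N * i)%:R : R) <= tower R j.+3 / 2.
  move=> i8; rewrite ler_pdivlMr// -[j.+3]addn3 towerE.
  apply: (@le_trans _ _ (expR ((N * i)%:R) * expR 1)).
    by rewrite ler_pM2l// expR_gt0.
  by rewrite -expRD ler_expR natr1 ler_nat; move: N1 i8; clear; nia.
rewrite [leRHS]splitr lerD//.
  apply: le_trans (half 7 isT).
  rewrite -[j.+2]addn2 towerE (_ : (N * 7)%:R = (N * 3)%:R + (N * 2 ^ 2)%:R :> R); last first.
    by rewrite -natrD; congr _%:R; lia.
  rewrite expRD ler_pM2r ?expR_gt0// natrM expRM_natl.
  rewrite lerXn2r ?nnegrE ?expR_ge0// -[3%:R]mulr1 expRM_natl.
  rewrite (_ : 8 = 2 ^+ 3); last by rewrite -natrX.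
  by rewrite lerXn2r ?nnegrE ?expR_ge0.
apply: le_trans (half 0 isT).
rewrite muln0 expR0 -[j.+4]addn4 towerE -expRM_natl -expRD.
by rewrite natrM (_ : _ + _ = 0) ?expR0//; ring.
Qed.

(** * Widths of the superlevel sets and their summability *)

Lemma nonincreasing_oo_measurable (R : realType) (a b : R) (f : R -> R) :
  {in `]a, b[ &, {homo f : x y /~ x <= y}} -> measurable_fun `]a, b[%classic f.
Proof.
move=> f_ni mD; apply: (measurability (@RGenCInfty.G R)) mD.
  exact: RGenCInfty.measurableE.
(* By monotonicity the preimage of a ray is an interval. *)
move=> _ [_ [r ->] <-]; apply: is_interval_measurable => s t/=.
move=> [sD rs] [tD rt] u /andP[su ut].
have uD : u \in `]a, b[.
  move: sD tD; rewrite !in_itv/= => /andP[a_s _] /andP[_ tb].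
  by rewrite (lt_le_trans a_s su) (le_lt_trans ut tb).
split=> //=; move: rt; rewrite !in_itv/= !andbT => rt.
by rewrite (le_trans rt)// f_ni.
Qed.

Lemma logp_ge0 (R : realType) (x : R) : 0 <= logp x.
Proof. by rewrite /logp; case: ifP => // /ln_ge0. Qed.

Lemma le_logp (R : realType) (x y : R) : x <= y -> logp x <= logp y.
Proof.
move=> xy; rewrite {1}/logp; case: ifP => x1; last exact: logp_ge0.
rewrite /logp (le_trans x1 xy) ler_ln// posrE (lt_le_trans ltr01)//.
exact: le_trans xy.
Qed.

Lemma logp_logp_tower (R : realType) (k : nat) (x : R) :
  tower R k <= x -> k%:R * ln 2 <= logp (logp x).
Proof.
move=> kx; apply: (@le_trans _ _ (logp (logp (tower R k)))); last first.
  by apply: le_logp; exact: le_logp.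
have k1 : 1 <= 2 ^+ k :> R by rewrite exprn_ege1// ler1n.
have t1 : 1 <= tower R k.
  by rewrite -[X in X <= _]expR0 ler_expR exprn_ge0.
by rewrite [logp (tower R k)]/logp t1 expRK /logp k1 lnXn// mulr_natl.
Qed.

Section width.
Context {R : realType} (h : R) (M : R -> R).
Hypothesis h0 : 0 < h.
Hypothesis M_decr : forall y1 y2, 0 < y1 -> y1 <= y2 -> y2 < h -> M y2 <= M y1.

(** Adding 0 keeps the set nonempty, so that its supremum is 0 when [M] never exceeds the level. *)
Let superlevel (k : nat) : set R :=
  [set y | y = 0 \/ (0 < y < h /\ tower R k < M y)].

Definition width (k : nat) : R := sup (superlevel k).

Let has_sup_superlevel k : has_sup (superlevel k).
Proof.
split; first by exists 0; left.
by exists h => y [->|[/andP[_ /ltW]]//]; exact: ltW.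
Qed.

Lemma width_ge0 k : 0 <= width k.
Proof. by apply: ub_le_sup; [exact: (has_sup_superlevel k).2|left]. Qed.

Lemma width_le k : width k <= h.
Proof.
apply: ge_sup; first exact: (has_sup_superlevel k).1.
by move=> y [->|[/andP[_ /ltW]]//]; exact: ltW.
Qed.

Lemma le_tower_gt_width k y : width k < y < h -> M y <= tower R k.
Proof.
move=> /andP[wy yh]; rewrite leNgt; apply/negP => kM.
have y0 : 0 < y by rewrite (le_lt_trans (width_ge0 k)).
have : y <= width k.
  by apply: ub_le_sup; [exact: (has_sup_superlevel k).2|right; rewrite y0].
by rewrite leNgt wy.
Qed.

(** Some point of the superlevel set lies beyond [y], and [M] is decreasing: the set is an interval
    starting at 0. *)
Lemma gt_tower_lt_width k y : 0 < y < width k -> tower R k < M y.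
Proof.
move=> /andP[y0 yw]; have d0 : 0 < width k - y by rewrite subr_gt0.
have [z zS] := sup_adherent d0 (has_sup_superlevel k).
rewrite -/(width k) opprB addrC subrK => yz.
case: zS => [z0|[/andP[z0 zh] kM]].
  by move: yz; rewrite z0 ltNge ltW.
by rewrite (lt_le_trans kM)// M_decr// ltW.
Qed.

(** A layer-cake bound. Exceeding level [k] gives a double logarithm of at least [k ln 2], which
    pays for the levels [1, ..., k]; this is why the widths are counted from index 1. *)
Lemma sum_indic_width y n : 0 < y < h ->
  \sum_(k < n) ln 2 * \1_(`]0, width k.+1[%classic) y <= logp (logp (M y)).
Proof.
move=> /andP[y0 yh]; elim: n => [|n IH]; first by rewrite big_ord0 logp_ge0.
(* Either the last indicator vanishes at [y], or [M y] exceeds level [n + 1] and even the full sum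
   of [ln 2] is covered. *)
have [yw|wy] := ltP y (width n.+1); last first.
  rewrite big_ord_recr/= indicE memNset ?mulr0 ?addr0//=.
  by rewrite in_itv/= y0/=; apply/negP; rewrite -leNgt.
apply: (@le_trans _ _ (n.+1%:R * ln 2)); last first.
  by apply: logp_logp_tower; apply: ltW; apply: gt_tower_lt_width; rewrite y0.
apply: (@le_trans _ _ (\sum_(k < n.+1) ln 2)); last first.
  by rewrite sumr_const card_ord mulr_natl.
apply: ler_sum => k _; rewrite indicE; case: (_ \in _); rewrite ?mulr1// mulr0.
by rewrite ln_ge0// ler1n.
Qed.

Lemma measurable_logp_logp :
  measurable_fun `]0, h[%classic (fun y => logp (logp (M y))).
Proof.
apply: nonincreasing_oo_measurable => x y; rewrite !in_itv/=.
move=> /andP[x0 xh] /andP[y0 yh] yx; apply: le_logp; apply: le_logp.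
exact: M_decr.
Qed.

Lemma sum_width_le n :
  ((\sum_(k < n) ln 2 * width k.+1)%:E <=
    \int[lebesgue_measure]_(y in `]0%R, h[%classic) (logp (logp (M y)))%:E)%E.
Proof.
pose f (k : nat) (y : R) : R := ln 2 * \1_(`]0, width k.+1[%classic) y.
have ln20 : 0 <= ln 2 :> R by rewrite ln_ge0// ler1n.
have f0 k y : 0 <= f k y by rewrite /f mulr_ge0.
have mf k : measurable_fun `]0, h[%classic (fun y => (f k y)%:E).
  by apply/measurable_EFinP; apply: measurable_funM.
have -> : (\sum_(k < n) ln 2 * width k.+1)%:E =
    (\int[lebesgue_measure]_(y in `]0%R, h[%classic)
       (\sum_(k <- index_enum 'I_n) (f k y)%:E))%E.
  rewrite ge0_integral_sum//; last 2 first.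
  - by move=> k; exact: mf.
  - by move=> k y _; rewrite lee_fin.
  rewrite -sumEFin; apply: eq_bigr => k _.
  have := @integralZl_indic _ _ R lebesgue_measure _ (measurable_itv `]0, h[)
    (fun=> `]0, width k.+1[%classic) (ln 2).
  rewrite -/(f k) => ->//; last by rewrite ltNge ln20.
  rewrite integral_indic// setIidl; last first.
    move=> y /=; rewrite !in_itv/= => /andP[-> yw].
    by rewrite (lt_le_trans yw)// width_le.
  rewrite /= lebesgue_measure_itv/= lte_fin; case: ltP => [w0|w0].
    by rewrite -EFinD subr0.
  have -> : width k.+1 = 0 by apply/eqP; rewrite eq_le w0 width_ge0.
  by rewrite mulr0 mule0.
apply: ge0_le_integral => //.
- by move=> y _; apply: sume_ge0 => k _; rewrite lee_fin.
- by apply: emeasurable_sum => k; exact: mf.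
- by apply/measurable_EFinP; exact: measurable_logp_logp.
- move=> y /=; rewrite in_itv/= => yh; rewrite sumEFin lee_fin.
  exact: sum_indic_width.
Qed.

End width.

(** * Small tails and a preliminary bound by compactness *)

Lemma small_tail (R : realType) (w : nat -> R) (C : R) :
  (forall k, 0 <= w k) -> (forall n, \sum_(0 <= k < n) w k <= C) ->
  forall eps : R, 0 < eps ->
  exists m, forall n, (m <= n)%N -> \sum_(m <= k < n) w k <= eps.
Proof.
move=> w0 wC eps eps0.
pose S := range (fun n => \sum_(0 <= k < n) w k).
have supS : has_sup S.
  by split; [exists (\sum_(0 <= k < 0) w k), 0%N|exists C => _ [n _ <-]].
(* After a partial sum within [eps] of the supremum, later ones can gain at most [eps]. *)
have [_ [m _ <-] Hm] := sup_adherent eps0 supS.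
exists m => n mn.
have : \sum_(0 <= k < n) w k <= sup S by apply: ub_le_sup; [exact: supS.2|exists n].
by rewrite (big_cat_nat_idem _ (leq0n m) mn)//=; lra.
Qed.

Lemma closed_box_compact (R : realType) (d : nat) (p0 : 'rV[R]_d) (eta : R) :
  0 <= eta -> compact [set q : 'rV[R]_d | `|q - p0| <= eta].
Proof.
move=> eta0.
rewrite (_ : [set q | _] = [set q : 'rV[R]_d | forall i,
    `[p0 0 i - eta, p0 0 i + eta]%classic (q 0 i)]).
  apply: (@rV_compact R d (fun i => `[p0 0 i - eta, p0 0 i + eta]%classic)).
  by move=> i; exact: segment_compact.
apply/seteqP; split => q /=; rewrite rV_norm_le// => H.
  move=> i; have /forallP/(_ i) := H.
  by rewrite !mxE in_itv/= ler_distl.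
by apply/forallP => i; have := H i; rewrite !mxE in_itv/= ler_distl.
Qed.

(** Starting point of the descending induction: the level [n] depends on [u], but does not enter the
    final bound. *)
Lemma bounded_by_tower (R : realType) (d : nat) (u : 'rV[R]_d -> R)
    (p0 : 'rV[R]_d) (eta : R) (m : nat) :
  0 <= eta -> (forall q, `|q - p0| <= eta -> {for q, continuous u}) ->
  exists2 n, (m <= n)%N & forall q, `|q - p0| <= eta -> `|u q| <= tower R n.
Proof.
move=> eta0 cu.
have cu' : {within [set q | `|q - p0| <= eta], continuous (fun q => `|u q|)}.
  apply: continuous_in_subspaceT => q /[!inE] /cu cuq.
  exact: (continuous_comp cuq (@norm_continuous _ _ _)).
have ne : [set q | `|q - p0| <= eta] !=set0 by exists p0; rewrite /= subrr normr0.
have [c _ cmax] := compact_EVT_max ne (@closed_box_compact R d p0 eta eta0) cu'.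
exists (maxn m (Num.trunc `|u c|).+1); first exact: leq_maxl.
move=> q qp; rewrite (le_trans (cmax _ (mem_set qp)))//.
apply: le_trans (ler_tower R (leq_maxr m _)).
have /ltW := truncnS_gt `|u c|; move=> /le_trans; apply.
rewrite (le_trans _ (expR_ge1Dx _))// -natrX.
by rewrite (@le_trans _ _ (2 ^ (Num.trunc `|u c|).+1)%:R) ?lerDr// ler_nat ltnW// ltn_expl.
Qed.

(** * Descent through the levels *)

Section majorized.
Context {R : realType} {d : nat} (i0 : 'I_d) (w : nat -> R).
Hypothesis w_ge0 : forall k, 0 <= w k.

(* The geometric term only serves to make the radius positive. *)
Definition jump (j : nat) : R := w j.+2 + 2^-1 ^+ j.

Lemma jump_gt0 j : 0 < jump j.
Proof. by rewrite ltr_wpDl// exprn_gt0// invr_gt0. Qed.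

(** Radius [r j] goes with level [j + 3]: passing from level [j + 4] on radius [r j.+1] to level
    [j + 3] on radius [r j] spends [reach R d * jump j]. The descent ends at [r m = 0], which leaves
    the point [p0]. *)
Lemma majorized_le_tower (u : 'rV[R]_d -> R) (p0 : 'rV[R]_d) (eta : R)
    (m : nat) :
  0 <= eta ->
  (forall n, (m <= n)%N -> \sum_(m <= j < n) reach R d * jump j <= eta) ->
  (forall q, `|q - p0| <= eta -> sharmonic_at u q) ->
  (forall k q, `|q - p0| <= eta -> w k < `|q 0 i0| -> `|u q| <= tower R k) ->
  `|u p0| <= tower R m.+3.
Proof.
move=> eta0 sum_le hu uw.
have [n mn un] : exists2 n, (m.+3 <= n)%N &
    forall q, `|q - p0| <= eta -> `|u q| <= tower R n.
  by apply: bounded_by_tower => // q /hu[].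
pose r k := \sum_(m <= j < k) reach R d * jump j.
suff main k : (k <= n - m.+3)%N -> forall q, `|q - p0| <= r (n - 3 - k)%N ->
    `|u q| <= tower R (n - k).
  have := main _ (leqnn _) p0; rewrite subKn//; apply.
  rewrite subrr normr0 /r (_ : (n - 3 - (n - m.+3))%N = m) ?big_geq//.
  by move: mn; clear; lia.
elim: k => [_|k IH kn] q qr.
  rewrite subn0; apply: un; apply: (le_trans qr); rewrite subn0; apply: sum_le.
  by move: mn; clear; lia.
pose j := (n - 3 - k.+1)%N.
have jE : (n - 3 - k = j.+1)%N by rewrite /j; move: kn; clear; lia.
have mj : (m <= j)%N by rewrite /j; move: kn; clear; lia.
have -> : (n - k.+1 = j.+3)%N by rewrite /j; move: kn; clear; lia.
have {}IH p : `|p - p0| <= r j.+1 -> `|u p| <= tower R j.+4.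
  rewrite (_ : j.+4 = n - k)%N; last by rewrite /j; move: kn; clear; lia.
  by rewrite -jE; apply: IH; rewrite ltnW.
have near_q p : `|p - q| <= reach R d * jump j -> `|p - p0| <= r j.+1.
  move=> pq; rewrite (_ : p - p0 = (q - p0) + (p - q)); last first.
    by rewrite [RHS]addrC addrA subrK.
  by rewrite (le_trans (ler_normD _ _))// /r big_nat_recr//= lerD.
have r_le : r j.+1 <= eta by apply: sum_le; rewrite leqW.
apply: le_trans (tower_step R j).
(* Moving away from the hyperplane turns [|q 0 i0|] into [|q 0 i0| + s], so steps longer than
   [jump j] leave the strip of half-width [w j.+2]. *)
pose sigma : R := if 0 <= q 0 i0 then 1 else -1.
have sigma1 : `|sigma| = 1.
  by rewrite /sigma; case: ifP => _; rewrite ?normrN normr1.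
apply: (@propagation_of_smallness R d i0 u q (jump j) sigma) => //.
- by rewrite expn_gt0.
- exact: jump_gt0.
- exact/ltW/tower_gt0.
- exact: tower_gt0.
- by move=> p /near_q pr; split; [apply/hu/(le_trans pr)|exact: IH].
move=> s /andP[js sj].
have s0 : 0 < s by apply: lt_trans js; exact: jump_gt0.
apply: uw.
  apply: le_trans r_le; apply: near_q.
  rewrite addrAC subrr add0r norm_delta_mx normrM sigma1 mul1r gtr0_norm//.
  rewrite (le_trans sj)// ler_pM2r ?jump_gt0// /reach lerDl.
  by rewrite !mulr_ge0 ?expR_ge0// addr_ge0.
have -> : `|(q + (sigma * s) *: delta_mx 0 i0) 0 i0| = `|q 0 i0| + s.
  rewrite !mxE !eqxx mulr1 /sigma; case: (leP 0 (q 0 i0)) => q0.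
    by rewrite mul1r !ger0_norm// addr_ge0// ltW.
  by rewrite mulN1r !ltr0_norm; [ring|done|lra].
apply: (@lt_le_trans _ _ s); last by rewrite lerDr.
by apply: le_lt_trans js; rewrite /jump lerDl exprn_ge0// invr_ge0.
Qed.

Lemma sum_jump_le (C : R) : (forall n, \sum_(k < n) w k.+1 <= C) ->
  forall n, \sum_(0 <= j < n) jump j <= C + 2.
Proof.
move=> wC n; rewrite big_split/= lerD//.
  (* The widths in [jump] start at index 2, so one more term, [w 1], completes the sum. *)
  apply: le_trans (wC n.+1); rewrite big_mkord big_ord_recl lerDr.
  by rewrite w_ge0.
have half1 : 1 - 2^-1 = 2^-1 :> R by rewrite {1}[1]splitr div1r addrK.
have geo : (1 - 2^-1) * \sum_(0 <= j < n) 2^-1 ^+ j = 1 - 2^-1 ^+ n :> R.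
  elim: n => [|n IH]; first by rewrite big_geq// expr0 subrr mulr0.
  by rewrite big_nat_recr//= mulrDr IH exprS; field.
have p0 : 0 <= 2^-1 ^+ n :> R by rewrite exprn_ge0// invr_ge0.
by move: geo; rewrite half1; lra.
Qed.

End majorized.

(** * Topology of the cylinder and conclusion *)

Lemma enorm_continuous (R : realType) (d : nat) : continuous (@enorm R d).
Proof.
move=> x.
have cs : {for x, continuous (fun y : 'rV[R]_d => \sum_(i < d) y 0 i ^+ 2)}.
  apply: (@continuous_at_sum R _ _ _ (fun i (y : 'rV[R]_d) => y 0 i ^+ 2)) => i.
  by apply: continuousM; exact: coord_continuous.
exact: (continuous_comp cs (@sqrt_continuous R _)).
Qed.

Lemma ypartE (R : realType) (m : nat) (p : 'rV[R]_(m + 1)) :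
  ypart p = p 0 (rshift m 0).
Proof. by rewrite /ypart mxE. Qed.

Lemma xpart_continuous (R : realType) (m : nat) : continuous (@xpart R m).
Proof.
move=> p A /nbhs_ballP[e /= e0 eA]; apply/nbhs_ballP; exists e => //= q [_ pq].
by apply: eA; split=> // i j; rewrite !mxE; exact: pq.
Qed.

Lemma open_cylinder (R : realType) (m : nat) (r h : R) : open (cylinder m r h).
Proof.
rewrite (_ : cylinder m r h =
    (fun p => enorm (xpart p)) @^-1` [set x | x < r] `&`
    (fun p => `|p 0 (rshift m 0)|) @^-1` [set x | x < h]).
  apply: openI; apply: open_comp; [|exact: open_lt| |exact: open_lt].
    move=> p _; apply: (@continuous_comp _ _ _ (@xpart R m)).
      exact: xpart_continuous.
    exact: enorm_continuous.
  move=> p _; apply: (continuous_comp (@coord_continuous _ _ _ _ _ p)).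
  exact: norm_continuous.
by apply/seteqP; split => p; rewrite /cylinder /= ypartE.
Qed.

(** A Lebesgue number argument, through the near-covering form of compactness. *)
Lemma compact_uniform_box (R : realType) (d : nat) (K D : set 'rV[R]_d) :
  compact K -> open D -> K `<=` D ->
  exists2 eta : R, 0 < eta &
    forall p, K p -> forall q, `|q - p| <= eta -> D q.
Proof.
move=> /compact_near_coveringP Kc oD KD.
have := Kc R (0 : R)^'+ (fun eta p => forall q, `|q - p| <= eta -> D q) _.
case=> [p Kp|e /= e0 He].
  have /nbhs_normP[e /= e0 eD] : nbhs p D by exact: open_nbhs_nbhs (conj oD (KD _ Kp)).
  have e20 : 0 < e / 2 by rewrite divr_gt0.
  (* Half of [e] is for moving the centre, half for the box around it. *)
  exists (ball p (e / 2), [set eta | eta <= e / 2]).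
    by split; [exact: nbhsx_ballx|exact: nbhs_right_le].
  move=> [p' eta] /= [pp' eta_le] q qp'; apply: eD => /=.
  rewrite (_ : p - q = (p - p') + (p' - q)); last by rewrite addrA subrK.
  rewrite (le_lt_trans (ler_normD _ _))// [e]splitr ltr_leD//.
    by move: pp'; rewrite -ball_normE.
  by rewrite distrC (le_trans qp').
exists (e / 2); first by rewrite divr_gt0.
move=> p Kp; apply: (He (e / 2)) => //=; last by rewrite divr_gt0.
rewrite sub0r normrN gtr0_norm ?divr_gt0//.
by rewrite ltr_pdivrMr// ltr_pMr// ltr1n.
Qed.

Theorem theorem1p1 (R : realType) (n : nat) (r h : R) (M : R -> R)
  (n_ge2 : (2 <= n)%N) (r_gt0 : 0 < r) (h_gt0 : 0 < h)
  (M_ge0 : forall y, 0 < y < h -> 0 <= M y)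
  (M_decr : forall y1 y2, 0 < y1 -> y1 <= y2 -> y2 < h -> M y2 <= M y1)
  (M_loglog :
    (\int[lebesgue_measure]_(y in `]0%R, h[%classic) (logp (logp (M y)))%:E
       < +oo)%E)
  (K : set 'rV[R]_(n.-1 + 1)) (K_compact : compact K)
  (K_sub : K `<=` cylinder n.-1 r h) :
  (ereal_sup
     [set ereal_sup [set `|u p|%:E | p in K]
       | u in harmonic_majorized n.-1 r h M] < +oo)%E.
Proof.
have [eta eta0 K_box] := compact_uniform_box K_compact (@open_cylinder _ _ r h) K_sub.
set I := (\int[lebesgue_measure]_(y in _) _)%E in M_loglog.
have ln2 : 0 < ln 2 :> R by rewrite ln_gt0// ltr1n.
have I_ge0 : (0 <= I)%E.
  by apply: integral_ge0 => y _; rewrite lee_fin logp_ge0.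
have I_fin : I \is a fin_num by rewrite ge0_fin_numE.
pose w := width h M.
have w0 k : 0 <= w k by exact: width_ge0.
have w_sum N : \sum_(k < N) w k.+1 <= fine I / ln 2.
  rewrite ler_pdivlMr// mulrC mulr_sumr -lee_fin fineK//.
  exact: sum_width_le.
have reach0 := ltW (reach_gt0 R (n.-1 + 1)).
(* Here [m] is fixed by [eta] and the widths, before any [u] or [p] is introduced; this gives the
   uniformity. *)
have [|N|m tail] := @small_tail R (fun j => reach R (n.-1 + 1) * jump w j)
    (reach R (n.-1 + 1) * (fine I / ln 2 + 2)) _ _ eta eta0.
- by move=> j; rewrite mulr_ge0// ltW// jump_gt0.
- by rewrite -mulr_sumr ler_wpM2l//; exact: sum_jump_le.
apply: (@le_lt_trans _ _ (tower R m.+3)%:E); last exact: ltry.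
apply: ge_ereal_sup => _ [u [u_harm u_le] <-].
apply: ge_ereal_sup => _ [p Kp <-]; rewrite lee_fin.
apply: (@majorized_le_tower R _ (rshift n.-1 0) w w0 u p eta) => //.
- exact: ltW.
- by move=> q /(K_box p Kp) Dq; exact: (harmonic_sharmonic (@open_cylinder _ _ r h) u_harm).
move=> k q /(K_box p Kp) Dq; rewrite -ypartE => wq.
(* Off the strip [ypart q] is nonzero, as the majorization by [M] requires. *)
have q0 : 0 < `|ypart q| by rewrite (le_lt_trans (w0 k)).
apply: le_trans (u_le q Dq _) _; first by rewrite -normr_gt0.
by apply: (@le_tower_gt_width R h) => //; rewrite wq Dq.2.
Qed.
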